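(* Let $A$ be a finitely generated abelian group with $\operatorname{rank}(A)>0$ and with cyclic torsion subgroup. Then the space $\mathrm{CO}(A)$ of left-invariant circular orders on $A$ is a Cantor set (that is, it is homeomorphic to the Cantor set).
   Context: A left-invariant circular order on a group $G$ is a map $\phi:G^3\to\{-1,0,1\}$ such that: (DV) $\phi(x,y,z)=0$ if and only if at least two of $x,y,z$ are equal; (C) $\phi(g_1,g_2,g_3)-\phi(g_0,g_2,g_3)+\phi(g_0,g_1,g_3)-\phi(g_0,g_1,g_2)=0$ for all $g_0,g_1,g_2,g_3\in G$; (H) $\phi(gg_0,gg_1,gg_2)=\phi(g_0,g_1,g_2)$ for all $g,g_0,g_1,g_2\in G$. The set $\mathrm{CO}(G)$ of all left-invariant circular orders on $G$ is given the subspace topology from $\{-1,0,1\}^{G^3}$, which carries the product topology with $\{-1,0,1\}$ discrete. The trivial group counts as a cyclic torsion subgroup. *)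

(* Defs.v *)
From HB Require Import structures.
From mathcomp Require Import all_boot all_order all_algebra.
From mathcomp Require Import all_classical all_reals all_analysis.

Set Implicit Arguments.
Unset Strict Implicit.
Unset Printing Implicit Defensive.

Import Order.TTheory GRing.Theory Num.Theory.
Local Open Scope classical_set_scope.
Local Open Scope ring_scope.

(* Abelian groups are zmodTypes, written additively; [x *~ k] is the k-th power
   of x for k : int.  MathComp has no infinite counterpart of the finite-group
   notions below. *)

Definition finitely_generated (A : zmodType) : Prop :=
  exists (n : nat) (g : 'I_n -> A),
    forall x : A, exists c : 'I_n -> int, x = \sum_(i < n) g i *~ c i.

Definition Z_independent (A : zmodType) (n : nat) (g : 'I_n -> A) : Prop :=
  forall c : 'I_n -> int,
    \sum_(i < n) g i *~ c i = 0 -> forall i, c i = 0.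

(* The rank is the largest size of a Z-linearly independent family.  It is a
   relation because an arbitrary abelian group need not have finite rank. *)
Definition has_rank (A : zmodType) (r : nat) : Prop :=
  (exists g : 'I_r -> A, Z_independent g) /\
  (forall (n : nat) (g : 'I_n -> A), Z_independent g -> (n <= r)%N).

Definition torsion (A : zmodType) : set A :=
  [set x | exists2 n : nat, (0 < n)%N & x *+ n = 0].
Arguments torsion : clear implicits.

Definition cyclic_subgroup (A : zmodType) (H : set A) : Prop :=
  exists t : A, H = range (fun k : int => t *~ k).

Definition sign3 : Type :=
  discrete_topology {s : int | s \in [:: -1; 0; 1]}.

HB.instance Definition _ := SubType.copy sign3 {s : int | s \in [:: -1; 0; 1]}.
HB.instance Definition _ :=
  DiscreteTopology.copy sign3 (discrete_topology {s : int | s \in [:: -1; 0; 1]}).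

Definition left_invariant_circular_order
    (A : zmodType) (phi : A * A * A -> sign3) : Prop :=
  [/\ forall x y z, \val (phi (x, y, z)) = 0 <-> (x = y \/ y = z \/ x = z),
      forall g0 g1 g2 g3,
        \val (phi (g1, g2, g3)) - \val (phi (g0, g2, g3))
          + \val (phi (g0, g1, g3)) - \val (phi (g0, g1, g2)) = 0
    & forall g g0 g1 g2, phi (g + g0, g + g1, g + g2) = phi (g0, g1, g2)].

(* Seen as a type, [CO A] carries the subspace topology, which the library
   attaches to [set_type]. *)
Definition CO (A : zmodType) : set (prod_topology (fun _ : A * A * A => sign3)) :=
  [set phi | left_invariant_circular_order phi].
Arguments CO : clear implicits.

Definition homeomorphic (X Y : topologicalType) : Prop :=
  exists (f : X -> Y) (g : Y -> X),
    [/\ cancel f g, cancel g f, continuous f & continuous g].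

(* Main.v *)
From HB Require Import structures.
Require Import Defs.
From mathcomp Require Import all_boot all_order all_algebra.
From mathcomp Require Import all_classical all_reals all_analysis.
From mathcomp Require Import zify ring lra Rstruct.

(* A circular order phi on A gives the cocycle s(a,b) = phi(0,a,a+b), which is
   symmetric because A is abelian, hence an abelian central extension of A by Z
   together with a semigroup of positive elements avoiding 0.  Finitely many
   positive elements can be made positive by one homomorphism to Q
   (Fourier-Motzkin), and this splits s rationally: s(a,b) = eta a + eta b -
   eta (a+b) with |eta| < 1 on any prescribed finite set.  Then
   chi = (1 - eta)/2 is a character A -> Q/Z that is injective on torsion and
   induces phi on the finite set.  Its kernel is torsion-free, and nontrivial
   since A has positive rank; the lexicographic orders built from chi and the
   two opposite orders of the kernel agree with phi on the finite set but differ
   from each other, so phi is not isolated.  Existence of an order is the same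
   lexicographic construction, starting from a character injective on the cyclic
   torsion subgroup.  The rest is Brouwer's characterization of the Cantor set. *)

Set Implicit Arguments.
Unset Strict Implicit.
Unset Printing Implicit Defensive.

Import Order.TTheory GRing.Theory Num.Theory.
Local Open Scope classical_set_scope.
Local Open Scope ring_scope.

(** * Duality for semigroups in finitely generated abelian groups *)

Lemma exists_lt_all (R : realFieldType) (t : seq R) (x : R) :
  (forall y, y \in t -> x < y) -> exists2 z, x < z & forall y, y \in t -> z < y.
Proof.
elim: t => [_|y t IH xt]; first by exists (x + 1) => //; lra.
have [|z xz zt] := IH; first by move=> u ut; apply: xt; rewrite inE ut orbT.
have xy : x < y by apply: xt; rewrite inE eqxx.
exists (Num.min z ((x + y) / 2)); first by rewrite lt_min xz /=; lra.
move=> u; rewrite inE => /predU1P[->|ut]; rewrite gt_min; last by rewrite zt.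
by apply/orP; right; lra.
Qed.

(** Supplies the last coordinate in Fourier-Motzkin elimination: [s] collects its lower bounds, [t]
    its upper bounds, and either list may be empty. *)
Lemma exists_between (R : realFieldType) (s t : seq R) :
  (forall x y, x \in s -> y \in t -> x < y) ->
  exists z, (forall x, x \in s -> x < z) /\ (forall y, y \in t -> z < y).
Proof.
elim: s => [_|x s IH st].
  elim: t => [|y t [z [_ zt]]]; first by exists 0.
  exists (Num.min z (y - 1)); split=> // u.
  rewrite inE => /predU1P[->|ut]; rewrite gt_min; last by rewrite zt.
  by apply/orP; right; lra.
have [|z [sz zt]] := IH.
  by move=> u y us; apply: st; rewrite inE us orbT.
(* If [z <= x], a point just above [x] still exceeds the old elements of [s], which are all below
   [z]. *)
have [zx|xz] := leP z x; last first.
  by exists z; split=> // u; rewrite inE => /predU1P[->//|]; exact: sz.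
have [|w xw wt] := @exists_lt_all _ t x.
  by move=> y; apply: st; rewrite inE eqxx.
exists w; split=> // u; rewrite inE => /predU1P[->//|us].
by rewrite (lt_trans (sz _ us))// (le_lt_trans zx).
Qed.

Section SemigroupDuality.
Variables (B : zmodType) (g : nat -> B) (P : set B).
Hypotheses (PD : forall x y, P x -> P y -> P (x + y)) (P0 : ~ P 0).

Let comb n (v : nat -> int) : B := \sum_(i < n) g i *~ v i.
Let dot n (y : nat -> rat) (v : nat -> int) : rat := \sum_(i < n) y i * (v i)%:~R.

Let combL n (a b : int) v w :
  comb n (fun i => a * v i + b * w i) = comb n v *~ a + comb n w *~ b.
Proof.
rewrite /comb !mulrz_suml -big_split/=; apply: eq_bigr => i _.
by rewrite mulrzDr -!mulrzA [v i * _]mulrC [w i * _]mulrC.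
Qed.

Let dotL n y (a b : int) v w :
  dot n y (fun i => a * v i + b * w i) = a%:~R * dot n y v + b%:~R * dot n y w.
Proof.
rewrite /dot !mulr_sumr -big_split/=; apply: eq_bigr => i _.
by rewrite rmorphD !rmorphM/=; ring.
Qed.

Let PMz x (a : int) : 0 < a -> P x -> P (x *~ a).
Proof.
case: a => // -[//|n] _ Px; rewrite -pmulrn.
by elim: n => // n IH; rewrite mulrS; exact: PD.
Qed.

(* Fourier-Motzkin elimination of the last coordinate; when some relation
   involves that coordinate it is instead solved for. *)
Lemma semigroup_positive_functional n (F : seq (nat -> int)) :
  (forall v, v \in F -> P (comb n v)) ->
  exists y, (forall v, v \in F -> 0 < dot n y v) /\
            (forall v, comb n v = 0 -> dot n y v = 0).
Proof.
have set_last (y : nat -> rat) s k v :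
    dot k (fun i => if i == k then s else y i) v = dot k y v.
  by apply: eq_bigr => i _; rewrite ltn_eqF.
have comb_last k v : v k = 0 -> comb k.+1 v = comb k v.
  by move=> vk; rewrite /comb big_ord_recr/= vk mulr0z addr0.
elim: n F => [|n IH] F FP.
  exists (fun=> 0); split=> v; last by rewrite /dot big_ord0.
  by move/FP; rewrite /comb big_ord0.
have dotS y s v : dot n.+1 (fun i => if i == n then s else y i) v
    = dot n y v + s * (v n)%:~R.
  by rewrite {1}/dot big_ord_recr/= eqxx; congr (_ + _); exact: set_last.
have [[r [r0 rn]]|norel] := pselect (exists r, comb n.+1 r = 0 /\ r n != 0).
  (* Since [r] represents 0, [red v] represents a positive multiple of the element of [v], and its
     last coordinate vanishes. *)
  pose red (v : nat -> int) := fun i : nat => (r n * r n) * v i + (- (r n * v n)) * r i.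
  have redn v : red v n = 0 by rewrite /red; ring.
  have comb_red v : comb n (red v) = comb n.+1 v *~ (r n * r n).
    by rewrite -comb_last// combL r0 mul0rz addr0.
  have [|y [yF y0]] := IH [seq red v | v <- F].
    move=> _ /mapP[v vF ->]; rewrite comb_red; apply: PMz; last exact: FP.
    by rewrite -expr2 exprn_even_gt0.
  have rnQ : (r n)%:~R != 0 :> rat by rewrite intr_eq0.
  have rrQ : 0 < (r n * r n)%:~R :> rat.
    by rewrite ltr0z -expr2 exprn_even_gt0.
  have dot_red v : (r n * r n)%:~R * dot n.+1
      (fun i => if i == n then - dot n y r / (r n)%:~R else y i) v
      = dot n y (red v).
    by rewrite dotS dotL rmorphN !rmorphM/=; field.
  (* This last coordinate makes the functional vanish on [r]. *)
  exists (fun i => if i == n then - dot n y r / (r n)%:~R else y i).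
  split=> v H.
    by rewrite -(pmulr_rgt0 _ rrQ) dot_red; apply: yF; apply: map_f.
  apply/eqP; rewrite -(mulrI_eq0 _ (mulfI (lt0r_neq0 rrQ))) dot_red.
  by rewrite y0// comb_red H mul0rz.
have norel0 v : comb n.+1 v = 0 -> v n = 0.
  by move=> v0; apply/eqP; apply/negP => /negP vn; apply: norel; exists v.
pose Fp := [seq v <- F | 0 < v n]; pose Fm := [seq v <- F | v n < 0].
(* For [v] in [Fp] and [w] in [Fm] both coefficients are positive and the last coordinate
   cancels. *)
pose cross (v w : nat -> int) := fun i : nat => (- w n) * v i + v n * w i.
have [|y [yF y0]] :=
    IH ([seq v <- F | v n == 0] ++ [seq cross v w | v <- Fp, w <- Fm]).
  move=> u; rewrite mem_cat mem_filter => /orP[/andP[/eqP un uF]|].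
    by rewrite -comb_last//; exact: FP.
  move=> /allpairsP[[v w] /= []]; rewrite !mem_filter.
  move=> /andP[v0 vF] /andP[w0 wF] ->.
  rewrite -comb_last/cross; last by ring.
  by rewrite combL; apply: PD; apply: PMz; rewrite ?oppr_gt0//; exact: FP.
(* Positivity on [v] bounds the last coordinate from below if [v n > 0] and from above if [v n < 0];
   positivity on [cross v w] makes these bounds compatible. *)
have [|s [sp sm]] := @exists_between _
    [seq - dot n y v / (v n)%:~R | v <- Fp] [seq - dot n y v / (v n)%:~R | v <- Fm].
  move=> _ _ /mapP[v vF ->] /mapP[w wF ->].
  have : 0 < dot n y (cross v w).
    by apply: yF; rewrite mem_cat; apply/orP; right; apply/allpairsP; exists (v, w).
  move: vF wF; rewrite !mem_filter => /andP[v0 _] /andP[w0 _].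
  have v0Q : 0 < (v n)%:~R :> rat by rewrite ltr0z.
  have w0Q : 0 < - (w n)%:~R :> rat by rewrite oppr_gt0 ltrz0.
  rewrite dotL rmorphN/= => c0.
  rewrite -[X in _ < _ / X]opprK invrN mulrNN ltr_pdivrMr//.
  rewrite mulrAC ltr_pdivlMr//; lra.
exists (fun i => if i == n then s else y i); split=> v H; last first.
  by rewrite dotS norel0// mulr0 addr0 y0// -comb_last// norel0.
rewrite dotS; have [v0|v0|v0] := ltrgtP (v n) 0.
- have v0Q : 0 < - (v n)%:~R :> rat by rewrite oppr_gt0 ltrz0.
  have := sm _ (map_f _ (_ : v \in Fm)); rewrite mem_filter v0 => /(_ H).
  rewrite -[X in _ < _ / X]opprK invrN mulrNN ltr_pdivlMr//; lra.
- have v0Q : 0 < (v n)%:~R :> rat by rewrite ltr0z.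
  have := sp _ (map_f _ (_ : v \in Fp)); rewrite mem_filter v0 => /(_ H).
  rewrite ltr_pdivrMr//; lra.
- by rewrite v0 mulr0 addr0; apply: yF; rewrite mem_cat mem_filter v0 eqxx H.
Qed.

End SemigroupDuality.

(** Generators and coordinates are padded by 0 to all of [nat], which suits induction on the number
    of generators. *)
Lemma finitely_generated_coordinates (B : zmodType) :
  finitely_generated B ->
  exists (n : nat) (g : nat -> B) (c : B -> nat -> int),
    forall x, x = \sum_(i < n) g i *~ c x i.
Proof.
move=> [n [g gen]]; have [c cE] := choice gen.
exists n, (fun i => oapp g 0 (insub i)), (fun x i => oapp (c x) 0 (insub i)).
by move=> x; rewrite [LHS]cE; apply: eq_bigr => i _; rewrite !valK.
Qed.

(** A functional that kills all relations among the generators descends to [B]: the chosen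
    coordinates [c] need not be additive, but their defect of additivity is a relation. *)
Lemma fg_positive_hom (B : zmodType) (P : set B) (F : seq B) :
  finitely_generated B ->
  (forall x y, P x -> P y -> P (x + y)) -> ~ P 0 ->
  (forall x, x \in F -> P x) ->
  exists f : B -> rat, {morph f : x y / x + y} /\ (forall x, x \in F -> 0 < f x).
Proof.
move=> /finitely_generated_coordinates[n [g [c cE]]] PD P0 FP.
have [|y [yF y0]] :=
    semigroup_positive_functional (g := g) (n := n) PD P0 (F := map c F).
  by move=> _ /mapP[x xF ->]; rewrite -cE; exact: FP.
exists (fun x => \sum_(i < n) y i * (c x i)%:~R); split=> [a b|x xF]; last first.
  by apply: yF; exact: map_f.
have : \sum_(i < n) g i *~ (c (a + b) i - c a i - c b i) = 0.
  transitivity (a + b - a - b); last by rewrite -addrA -opprD subrr.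
  rewrite [X in _ = X - _ - _]cE [X in _ = _ - X - _]cE [X in _ = _ - X]cE.
  by rewrite -!sumrB; apply: eq_bigr => i _; rewrite !mulrzBr.
move/(y0 (fun i => c (a + b) i - c a i - c b i)) => H.
apply/eqP; rewrite -subr_eq0 opprD addrA -!sumrB -[X in _ == X]H; apply/eqP.
by apply: eq_bigr => i _; rewrite !rmorphB/=; ring.
Qed.

(** * Symmetric cocycles and abelian central extensions by the integers *)

Record symmetric_cocycle (A : zmodType) := SymmetricCocycle {
  cocycle_fun :> A -> A -> int;
  cocycle_sym : forall a b, cocycle_fun a b = cocycle_fun b a;
  cocycle0 : forall a, cocycle_fun 0 a = 0;
  cocycleA : forall a b c, cocycle_fun a b + cocycle_fun (a + b) c
    = cocycle_fun b c + cocycle_fun a (b + c) }.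

(** An alias of the product indexed by [s], so that each cocycle gets its own twisted group law. *)
Definition central_extension (A : zmodType) (s : symmetric_cocycle A) : Type :=
  (A * int)%type.

Section CentralExtension.
Variables (A : zmodType) (s : symmetric_cocycle A).
Local Notation E := (central_extension s).

HB.instance Definition _ := Choice.copy E (A * int)%type.

Let addE (u v : E) : E := (u.1 + v.1, u.2 + v.2 + s u.1 v.1).
Let oppE (u : E) : E := (- u.1, - u.2 - s u.1 (- u.1)).

Let addEA : associative addE.
Proof.
move=> [a i] [b j] [c k]; rewrite /addE/= addrA; congr pair.
by have := cocycleA s a b c; lia.
Qed.

Let addEC : commutative addE.
Proof.
move=> [a i] [b j]; rewrite /addE/= addrC; congr pair.
by rewrite cocycle_sym [i + j]addrC.
Qed.

Let add0E : left_id (0, 0) addE.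
Proof. by move=> [a i]; rewrite /addE/= cocycle0 !add0r addr0. Qed.

Let addNE : left_inverse (0, 0) oppE addE.
Proof.
move=> [a i]; rewrite /addE/= addNr; congr pair.
by rewrite cocycle_sym; lia.
Qed.

HB.instance Definition _ := GRing.isZmodule.Build E addEA addEC add0E addNE.

Lemma central_extensionD (u v : E) : u + v = (u.1 + v.1, u.2 + v.2 + s u.1 v.1).
Proof. by []. Qed.

Lemma central_extension_fg : finitely_generated A -> finitely_generated E.
Proof.
move=> [n [g gen]].
exists n.+1, (fun i => oapp (fun j => (g j, 0)) (0, 1) (unlift ord0 i)).
move=> [a k]; have [c cE] := gen a.
have fstD : {morph (fst : E -> A) : u v / u + v} by [].
(* [w] lies over [a]; adding [k - w.2] copies of the central generator [(0, 1)] corrects the second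
   entry. *)
pose w : E := \sum_(i < n) ((g i, 0) : E) *~ c i.
have fst_z (u : E) m : (u *~ m).1 = u.1 *~ m.
  have fst_n (v : E) p : (v *+ p).1 = v.1 *+ p.
    by elim: p => // p IH; rewrite !mulrS -IH.
  by case: m => p; [exact: fst_n|rewrite !NegzE !mulrNz -!pmulrn -fst_n].
have w1 : w.1 = a.
  rewrite cE /w (big_morph _ fstD (erefl : (0 : E).1 = 0)).
  by apply: eq_bigr => i _; rewrite fst_z.
have zE m : ((0, 1) : E) *~ m = (0, m).
  have zn p : ((0, 1) : E) *+ p = (0, p%:Z).
    elim: p => // p IH; rewrite mulrS IH central_extensionD/= cocycle0.
    by rewrite !addr0 intS.
  case: m => p; first exact: zn.
  rewrite NegzE mulrNz -pmulrn zn; congr pair; rewrite /= ?oppr0//.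
  by rewrite cocycle0 subr0.
exists (fun i => oapp c (k - w.2) (unlift ord0 i)).
rewrite big_ord_recl unlift_none/= zE.
under eq_bigr do rewrite liftK/=.
by rewrite -/w central_extensionD/= cocycle0 w1 add0r subrK addr0.
Qed.

End CentralExtension.

(** * The cocycle of a circular order *)

Lemma sign3_cases (e : sign3) : [\/ val e = -1, val e = 0 | val e = 1].
Proof.
by case: e => e /=; rewrite !inE => /or3P[] /eqP->; constructor.
Qed.

Section CircularOrder.
Variables (A : zmodType) (phi : A * A * A -> sign3).
Hypothesis co : left_invariant_circular_order phi.

Definition order_cocycle (a b : A) : int := val (phi (0, a, a + b)).

Lemma order_cocycle_cases a b :
  [\/ order_cocycle a b = -1, order_cocycle a b = 0 | order_cocycle a b = 1].
Proof. exact: sign3_cases. Qed.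

Lemma order_cocycle_eq0 a b :
  order_cocycle a b = 0 <-> (a = 0 \/ b = 0 \/ a + b = 0).
Proof.
rewrite /order_cocycle; have [-> _ _] := co.
split=> -[|[]] H; [left|right; left|right; right|left|right; left|right; right].
- by rewrite H.
- by apply: (addrI a); rewrite -H addr0.
- by rewrite H.
- by rewrite H.
- by rewrite H addr0.
- by rewrite H.
Qed.

(** The cocycle condition at 0, a, a + b, a + b + c, whose first term is translated back by a. *)
Lemma order_cocycleA a b c :
  order_cocycle a b + order_cocycle (a + b) c
    = order_cocycle b c + order_cocycle a (b + c).
Proof.
have [_ /(_ 0 a (a + b) (a + b + c)) C H] := co.
have := H a 0 b (b + c); rewrite addr0 !addrA => Ha.
move: C; rewrite Ha /order_cocycle !addrA.
by move: (\val _) (\val _) (\val _) (\val _); lia.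
Qed.

(* The commutator pairing [k a b] doubles when [b] does, yet it is bounded. *)
Lemma order_cocycleC a b : order_cocycle a b = order_cocycle b a.
Proof.
pose k x y := order_cocycle x y - order_cocycle y x.
have k2 x y : k x (y + y) = k x y + k x y.
  have := (order_cocycleA x y y, order_cocycleA y y x, order_cocycleA y x y).
  by rewrite /k [y + x]addrC => -[[]]; lra.
(* Doubling twice gives [k a (b + b + (b + b))] as four times [k a b]; it is at most 2 in absolute
   value, so the integer [k a b] is 0. *)
have := (k2 a b, k2 a (b + b)); rewrite /k => -[].
have [] := order_cocycle_cases a (b + b + (b + b));
have [] := order_cocycle_cases (b + b + (b + b)) a; lia.
Qed.

Lemma order_cocycle0 a : order_cocycle 0 a = 0.
Proof. by apply/order_cocycle_eq0; left. Qed.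

Definition order_symmetric_cocycle :=
  SymmetricCocycle order_cocycleC order_cocycle0 order_cocycleA.

Local Notation E := (central_extension order_symmetric_cocycle).

(* [E] contains with index 2 the extension attached to the {0,1}-valued cocycle
   of [phi]; that subgroup consists of the pairs whose second entry is even if
   and only if the first is 0, and [positive_lift] is its positive cone. *)
Let positive_lift : set E := [set u |
  (u.1 <> 0 /\ exists k : nat, u.2 = k%:Z * 2 + 1) \/
  (u.1 = 0 /\ exists k : nat, u.2 = k%:Z * 2 + 2)].

(** Two odd positive second entries add up to an even number at least 2. If the first entries are
    nonzero with nonzero sum, the cocycle shifts it by 1 or -1, leaving a positive odd number;
    otherwise the cocycle vanishes. *)
Let positive_liftD u v :
  positive_lift u -> positive_lift v -> positive_lift (u + v).
Proof.
move: u v => [a i] [b j]; rewrite /positive_lift/= => -[] [a0 [k ->]] [] [b0 [l ->]].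
- have [ab|ab] := pselect (a + b = 0).
    right; split=> //; exists (k + l)%N.
    have -> : order_cocycle a b = 0 by apply/order_cocycle_eq0; do 2 right.
    lia.
  left; split=> //.
  have [->|s0|->] := order_cocycle_cases a b.
  + by exists (k + l)%N; lia.
  + by case/order_cocycle_eq0 : s0 => // -[].
  + by exists (k + l).+1; lia.
- left; rewrite b0 addr0; split=> //; exists (k + l).+1.
  have -> : order_cocycle a 0 = 0 by apply/order_cocycle_eq0; right; left.
  lia.
- left; rewrite a0 add0r; split=> //; exists (k + l).+1.
  by rewrite order_cocycle0; lia.
- right; rewrite a0 b0 add0r; split=> //; exists (k + l).+1.
  by rewrite order_cocycle0; lia.
Qed.

Let positive_lift0 : ~ positive_lift 0.
Proof. by move=> [] [] // _ [k] /=; lia. Qed.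

(** A homomorphism [f] on the extension, divided by its value on the central generator and
    restricted to the elements [(a, 0)], splits the cocycle. Positivity of [f] at [(a, 1)] and
    [(- a, 1)] bounds [eta a] below by -1 and above by 1. *)
Lemma order_cocycle_split (S : seq A) : finitely_generated A ->
  exists eta : A -> rat,
    (forall a b, eta a + eta b - eta (a + b) = (order_cocycle a b)%:~R) /\
    (forall a, a \in S -> `|eta a| < 1).
Proof.
move=> fg; pose lift1 (a : A) : E := (a, 1); pose z : E := (0, 1).
pose lift0 (a : A) : E := (a, 0).
pose S' := [seq a <- S | a != 0].
have sN a : order_cocycle a (- a) = 0.
  by apply/order_cocycle_eq0; rewrite subrr; do 2 right.
(* Over 0 the cone requires an even second entry: hence [z + z] instead of [z], and the removal of 0
   from [S]. *)
have [x|f [fD fF]] := fg_positive_hom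
    (F := z + z :: map lift1 S' ++ map (lift1 \o -%R) S')
    (central_extension_fg _ fg) positive_liftD positive_lift0.
  rewrite inE mem_cat => /predU1P[->|/orP[]/mapP[a]].
  - by right; split; rewrite /= ?addr0//; exists 0%N; rewrite order_cocycle0.
  - rewrite mem_filter => /andP[/eqP a0 _] ->.
    by left; split=> //; exists 0%N.
  - rewrite mem_filter => /andP[/eqP a0 _] ->.
    left; split; last by exists 0%N.
    by move/eqP; rewrite oppr_eq0 => /eqP.
have f0 : f 0 = 0 by apply: (addrI (f 0)); rewrite -fD !addr0.
have fz : 0 < f z.
  by have := fF (z + z); rewrite inE eqxx fD => /(_ isT); lra.
have fN a : f (lift0 (- a)) = - f (lift0 a).
  apply/eqP; rewrite -addr_eq0 -fD -f0; apply/eqP; congr f.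
  by rewrite /lift0 central_extensionD/= addNr order_cocycleC sN.
have fS a b :
    f (lift0 a) + f (lift0 b) = f (lift0 (a + b)) + (order_cocycle a b)%:~R * f z.
  have e n : f (lift0 (a + b)) + f (0, n) = f (a + b, n).
    rewrite -fD; congr f; rewrite central_extensionD/= order_cocycleC order_cocycle0.
    by rewrite !addr0 add0r.
  rewrite -fD central_extensionD/= !add0r -e; congr (_ + _).
  have [->|->|->] := order_cocycle_cases a b; last by rewrite mul1r.
    rewrite mulN1r; apply/eqP; rewrite -addr_eq0 -fD -f0; apply/eqP; congr f.
    by rewrite central_extensionD/= order_cocycle0 !addr0.
  by rewrite mul0r.
have f1 a : f (lift1 a) = f (lift0 a) + f z.
  rewrite -fD; congr f; rewrite central_extensionD/= order_cocycleC order_cocycle0.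
  by rewrite !addr0 add0r.
exists (fun a => f (lift0 a) / f z); split=> [a b|a aS].
  by rewrite -mulrDl fS -mulrBl addrAC subrr add0r mulfK// lt0r_neq0.
have [->|a0] := eqVneq a 0; first by rewrite [lift0 0]/(0 : E) f0 mul0r normr0.
have aS' : a \in S' by rewrite mem_filter a0.
have := fF (lift1 a); rewrite inE mem_cat map_f//= orbT f1 => /(_ isT) p1.
have := fF (lift1 (- a)); rewrite inE mem_cat (map_f (lift1 \o -%R))//= !orbT.
rewrite f1 fN => /(_ isT) p2.
by rewrite normrM normfV [`|f z|]gtr0_norm// ltr_pdivrMr// mul1r ltr_norml; lra.
Qed.

(** Each addition of [a] costs an error of at most 1, so [eta (a *+ m.+1)] is within [m] of [m.+1]
    times [eta a]. When [a *+ n.+1] is 0, this bounds [eta a] by [n / n.+1]. *)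
Lemma order_cocycle_split_torsion (eta : A -> rat) a :
  (forall a b, eta a + eta b - eta (a + b) = (order_cocycle a b)%:~R) ->
  torsion A a -> `|eta a| < 1.
Proof.
move=> etaE [[//|n] _ an].
have eta0 : eta 0 = 0.
  by have := etaE 0 0; rewrite order_cocycle0 addr0 addrK.
have H m : `|eta (a *+ m.+1) - m.+1%:R * eta a| <= m%:R.
  elim: m => [|m IH]; first by rewrite mulr1n mul1r subrr normr0.
  rewrite mulrS -[m.+2]addn1 natrD mulrDl mul1r.
  have -> : eta (a + a *+ m.+1) = eta a + eta (a *+ m.+1) - (order_cocycle a (a *+ m.+1))%:~R.
    by rewrite -etaE; ring.
  rewrite -[X in _ <= X%:R]addn1 natrD.
  have s1 : `|(order_cocycle a (a *+ m.+1))%:~R : rat| <= 1.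
    by have [->|->|->] := order_cocycle_cases a (a *+ m.+1).
  set s := (order_cocycle _ _)%:~R in s1 *.
  have -> : eta a + eta (a *+ m.+1) - s - (m.+1%:R * eta a + eta a)
    = (eta (a *+ m.+1) - m.+1%:R * eta a) - s by ring.
  by rewrite (le_trans (ler_normB _ _))// lerD.
have := H n; rewrite an eta0 sub0r normrN normrM normr_nat.
have n0 : 0 < n.+1%:R :> rat by rewrite ltr0n.
rewrite -ler_pdivlMl// => /le_lt_trans; apply.
by rewrite ltr_pdivrMl// mulr1 ltr_nat.
Qed.

End CircularOrder.

(** * Lexicographic circular orders *)

Section MaximalSemigroup.
Variable A : zmodType.

Lemma semigroup_mulrn (P : set A) a n :
  (forall x y, P x -> P y -> P (x + y)) -> P a -> P (a *+ n.+1).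
Proof. by move=> PD Pa; elim: n => // n IH; rewrite mulrS; exact: PD. Qed.

Lemma torsion0 : torsion A 0.
Proof. by exists 1%N. Qed.

Lemma torsion_mulrn a n : torsion A (a *+ n.+1) -> torsion A a.
Proof.
by move=> [m m0 amn]; exists (n.+1 * m)%N; rewrite ?muln_gt0 ?mulrnA.
Qed.

Lemma torsionN a : torsion A (- a) -> torsion A a.
Proof.
by move=> [m m0 /eqP]; rewrite mulNrn oppr_eq0 => /eqP am; exists m.
Qed.

(** Zorn's lemma for semigroups avoiding torsion. If a maximal one contained neither [a] nor [- a],
    it would contain a positive multiple of each, hence 0. *)
Lemma exists_maximal_semigroup : exists P : set A,
  [/\ forall x y, P x -> P y -> P (x + y),
      forall a, P a -> ~ torsion A a
    & forall a, ~ torsion A a -> P a \/ P (- a)].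
Proof.
pose Q := [set P : set A | (forall x y, P x -> P y -> P (x + y)) /\
                           (forall a, P a -> ~ torsion A a)].
have [F FQ Ftot|P [[PD PT] Pmax]] := @Zorn_bigcup A Q.
  split=> [x y [X FX Xx] [Y FY Yy]|a [X FX Xa]]; last exact: (FQ X FX).2.
  have [XY|YX] := Ftot _ _ FX FY.
    by exists Y => //; apply: (FQ Y FY).1 => //; exact: XY.
  by exists X => //; apply: (FQ X FX).1 => //; exact: YX.
exists P; split=> // a aT; apply: contrapT => /not_orP[Pa PNa].
(* By maximality, adjoining [e] creates a torsion element [p + e *+ n.+1]. Here [p] is not 0, as [e]
   is not torsion, and a multiple of [p] in [P] equals a negative multiple of [e]. *)
have extend e : ~ torsion A e -> ~ P e -> exists k, P (- (e *+ k.+1)).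
  move=> eT Pe.
  pose Pe' := [set x | P x \/ exists p n, (p = 0 \/ P p) /\ x = p + e *+ n.+1].
  have PPe : P `<` Pe'.
    split; first by move=> x; left.
    move=> /(_ e) H; apply/Pe/H; right; exists 0, 0%N.
    by rewrite add0r; split; [left|].
  apply: contrapT => noP; apply: (Pmax _ PPe); split=> [x y|x].
    move=> [Px|[p [n [pP ->]]]] [Py|[q [m [qP ->]]]].
    + by left; exact: PD.
    + right; exists (x + q), m; rewrite addrA; split=> //.
      by right; case: qP => [->|]; rewrite ?addr0//; exact: PD.
    + right; exists (p + y), n; rewrite addrAC; split=> //.
      by right; case: pP => [->|Pp]; rewrite ?add0r//; exact: PD.
    + right; exists (p + q), (n + m).+1; split; last first.
        by rewrite addrACA -mulrnDr addSn addnS.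
      case: pP => [->|Pp]; first by rewrite add0r.
      by case: qP => [->|Pq]; right; rewrite ?addr0//; exact: PD.
  move=> [/PT//|[p [n [pP ->]]]] [[//|m] _ H].
  case: pP => [p0|Pp].
    by apply/eT/(@torsion_mulrn _ n); exists m.+1 => //; rewrite -H p0 add0r.
  apply: noP; exists (n.+1 * m.+1).-1; rewrite prednK ?muln_gt0// mulrnA.
  move/eqP: H; rewrite mulrnDl addr_eq0 => /eqP <-.
  exact: (semigroup_mulrn _ PD).
have [k Pk] := extend _ aT Pa.
have NaT : ~ torsion A (- a) by move/torsionN.
have [l Pl] := extend _ NaT PNa.
apply: (PT 0); last exact: torsion0.
have -> : 0 = (- (a *+ k.+1)) *+ l.+1 + (- (- a *+ l.+1)) *+ k.+1.
  by rewrite !mulNrn opprK -!mulrnA mulnC addNr.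
by apply: (PD); exact: (semigroup_mulrn _ PD).
Qed.

End MaximalSemigroup.

(** * Circular orders from coboundaries *)

Section CoboundaryOrder.
Variables (A : zmodType) (eta : A -> rat).
Hypothesis etaN : forall a, eta (- a) = - eta a.
Hypothesis etaD : forall a b, a != 0 -> b != 0 -> a + b != 0 ->
  `|eta a + eta b - eta (a + b)| = 1.

(** The last branch is meant for -1; [cobP] shows that [cob] takes no values besides 0, 1 and -1. *)
Let sign3_of (q : rat) : sign3 :=
  if q == 0 then exist _ 0 isT else if q == 1 then exist _ 1 isT
  else exist _ (-1) isT.

Let cob x y z := eta (y - x) + eta (z - y) + eta (x - z).

Let eta0 : eta 0 = 0.
Proof. by have := etaN 0; rewrite oppr0; lra. Qed.

Let cobP x y z :
  if [|| x == y, y == z | x == z] then cob x y z = 0 else `|cob x y z| = 1.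
Proof.
have [->|xy] /= := eqVneq x y.
  by rewrite /cob subrr eta0 add0r -(opprB z y) etaN subrr.
have [->|yz] /= := eqVneq y z.
  by rewrite /cob subrr eta0 addr0 -(opprB x z) etaN addNr.
have [->|xz] /= := eqVneq x z.
  by rewrite /cob subrr eta0 addr0 -(opprB z y) etaN addNr.
have e : y - x + (z - y) = z - x by rewrite addrC subrKA.
have := @etaD (y - x) (z - y); rewrite e -etaN opprB; apply.
- by rewrite subr_eq0 eq_sym.
- by rewrite subr_eq0 eq_sym.
- by rewrite subr_eq0 eq_sym.
Qed.

Let sign3_of_cob x y z : (val (sign3_of (cob x y z)))%:~R = cob x y z.
Proof.
have := cobP x y z; case: ifP => [_ ->|_]; first by rewrite /sign3_of eqxx.
have [c0|c0] := leP 0 (cob x y z).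
  by rewrite ger0_norm// => ->.
rewrite ltr0_norm// => /eqP; rewrite eqr_oppLR => /eqP ->.
by [].
Qed.

(** A coboundary satisfies the cocycle condition, and invariance holds because only differences
    occur. For distinct points the sum is the defect of additivity of [eta], hence 1 or -1. *)
Lemma coboundary_circular_order : exists phi : A * A * A -> sign3,
  left_invariant_circular_order phi /\
  forall x y z, (val (phi (x, y, z)))%:~R = eta (y - x) + eta (z - y) + eta (x - z).
Proof.
exists (fun t => sign3_of (cob t.1.1 t.1.2 t.2)).
split; last by move=> x y z; exact: sign3_of_cob.
split=> /= [x y z|g0 g1 g2 g3|g g0 g1 g2].
- have := cobP x y z; case: ifPn => [/or3P H c0|/norP[xy /norP[yz xz]] c1].
    split=> _; last by apply/eqP; rewrite -(intr_eq0 rat) sign3_of_cob c0.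
    by case: H => /eqP ->; [left|right; left|right; right].
  split=> [e|[/eqP|[]/eqP]]; rewrite ?(negPf xy) ?(negPf yz) ?(negPf xz)//.
  have c0 := etrans (esym (sign3_of_cob x y z)) (congr1 intr e).
  by move: c1; rewrite c0 normr0 => /eqP; rewrite eq_sym oner_eq0.
- apply/eqP; rewrite -(intr_eq0 rat); apply/eqP.
  rewrite rmorphB rmorphD rmorphB/= !sign3_of_cob /cob.
  rewrite -(opprB g1 g3) -(opprB g0 g2) !etaN; ring.
- have e x y : g + x - (g + y) = x - y by rewrite opprD addrACA subrr add0r.
  by rewrite /cob !e.
Qed.

End CoboundaryOrder.

(* The representative of [chi a] modulo 1 in [0, 1]: a nonzero element of the
   kernel is placed just above 0 if it lies in [P], and just below 1 otherwise. *)
Definition lex_position (A : zmodType) (chi : A -> rat) (P : set A) (a : A) : rat :=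
  if chi a \is a Num.int then (~~ `[< P a >])%:R else chi a - (Num.floor (chi a))%:~R.

(* For distinct x, y, z the positions of y - x, z - y and x - z add up to 1 or 2
   according to the orientation of the triple; hence the values 1 and -1 of the
   sum of this function over the three differences. *)
Definition lex_coboundary (A : zmodType) (chi : A -> rat) (P : set A) (a : A) : rat :=
  if a == 0 then 0 else 1 - 2 * lex_position chi P a.

Section LexicographicOrder.
Variables (A : zmodType) (chi : A -> rat) (P : set A).
Hypothesis chiD : forall a b, chi (a + b) - chi a - chi b \is a Num.int.
Hypothesis PD : forall x y, P x -> P y -> P (x + y).
Hypothesis P0 : ~ P 0.
Hypothesis Ptotal : forall a, chi a \is a Num.int -> a != 0 -> P a \/ P (- a).

Local Notation pos := (lex_position chi P).

Let chi0 : chi 0 \is a Num.int.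
Proof. by have := chiD 0 0; rewrite addr0 subrr sub0r rpredN. Qed.

Let chiN a : chi (- a) + chi a \is a Num.int.
Proof.
have := rpredB chi0 (chiD (- a) a); rewrite addNr.
by rewrite (_ : _ - _ = chi (- a) + chi a)//; ring.
Qed.

Let pos_int a : chi a - pos a \is a Num.int.
Proof.
rewrite /lex_position; case: ifP => [ai|_]; first by rewrite rpredB ?natr_int// rpred_nat.
by rewrite opprB addrC subrK intr_int.
Qed.

Let pos_itv a : 0 <= pos a <= 1.
Proof.
rewrite /lex_position; case: ifP => [_|_]; first by case: (`[< _ >]).
by have := floor_itv (chi a); rewrite rmorphD/=; lra.
Qed.

Let pos_eq0 a : a != 0 -> pos a = 0 -> P a.
Proof.
rewrite /lex_position => a0; case: ifPn => [_|ai].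
  by case: asboolP => // _ /= /eqP; rewrite oner_eq0.
by move/subr0_eq => e; move: ai; rewrite e intr_int.
Qed.

Let pos_eq1 a : a != 0 -> pos a = 1 -> ~ P a /\ chi a \is a Num.int.
Proof.
rewrite /lex_position => a0; case: ifPn => [ai|ai].
  by case: asboolP => //= _ /eqP; rewrite eq_sym oner_eq0.
by have := floor_itv (chi a); rewrite rmorphD/=; lra.
Qed.

Let pos_eq1N a : a != 0 -> pos a = 1 -> P (- a).
Proof. by move=> a0 /pos_eq1[]// Pa ai; case: (Ptotal ai a0). Qed.

Let PN a : P a -> ~ P (- a).
Proof. by move=> Pa /(PD Pa); rewrite subrr. Qed.

Let int_itv (q : rat) : q \is a Num.int -> -1 < q < 2 -> q = 0 \/ q = 1.
Proof.
case/intrP => m ->; have -> : -1 = (-1)%:~R :> rat by [].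
have -> : 2 = 2%:~R :> rat by [].
rewrite !ltr_int => m12; have : m = 0 \/ m = 1 by lia.
by case=> ->; [left|right].
Qed.

(** The expression is an integer in [-1, 2]. The value -1 would put [a] and [b] in [P] but not
    [a + b]; the value 2 would put [- a], [- b] and [a + b] in [P]. *)
Let posD a b : a != 0 -> b != 0 -> a + b != 0 ->
  pos a + pos b - pos (a + b) = 0 \/ pos a + pos b - pos (a + b) = 1.
Proof.
move=> a0 b0 ab0; apply: int_itv.
  have -> : pos a + pos b - pos (a + b) = (chi (a + b) - pos (a + b))
      - (chi (a + b) - chi a - chi b) - (chi a - pos a) - (chi b - pos b) by ring.
  by do 2 (apply: rpredB; last exact: pos_int); exact: rpredB (pos_int _) (chiD _ _).
have := (pos_itv a, pos_itv b, pos_itv (a + b)) => -[[Ha Hb] Hab].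
apply/andP; split; rewrite lt_neqAle; apply/andP; split; try lra.
  apply/negP => /eqP H.
  have Pa : P a by apply: pos_eq0 => //; lra.
  have Pb : P b by apply: pos_eq0 => //; lra.
  have [|+ _] := @pos_eq1 (a + b) ab0; first by lra.
  by apply; exact: PD.
apply/negP => /eqP H.
have Pa : P (- a) by apply: pos_eq1N => //; lra.
have Pb : P (- b) by apply: pos_eq1N => //; lra.
have Pab : P (a + b) by apply: pos_eq0 => //; lra.
by apply: (PN Pab); rewrite opprD; exact: PD.
Qed.

(** The two positions have an integer sum in [0, 2]; either extreme would put both [a] and [- a] in
    [P]. *)
Let posN a : a != 0 -> pos (- a) = 1 - pos a.
Proof.
move=> a0; have na0 : - a != 0 by rewrite oppr_eq0.
have H : pos a + pos (- a) \is a Num.int.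
  have -> : pos a + pos (- a) = (chi (- a) + chi a)
      - (chi (- a) - pos (- a)) - (chi a - pos a) by ring.
  by do 2 (apply: rpredB; last exact: pos_int); exact: chiN.
have := (pos_itv a, pos_itv (- a)) => -[Ha Hna].
suff : pos a + pos (- a) = 1 by move=> <-; ring.
have [|H0|//] := int_itv H.
  apply/andP; split; first by lra.
  rewrite lt_neqAle; apply/andP; split; last by lra.
  apply/negP => /eqP H2; have Pa : P (- a) by apply: pos_eq1N => //; lra.
  by apply: (PN Pa); apply: pos_eq1N => //; lra.
have Pa : P a by apply: pos_eq0 => //; lra.
by case: (PN Pa); apply: pos_eq0 => //; lra.
Qed.

Lemma lexicographic_circular_order : exists phi : A * A * A -> sign3,
  left_invariant_circular_order phi /\
  forall x y z, (val (phi (x, y, z)))%:~R = lex_coboundary chi P (y - x)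
    + lex_coboundary chi P (z - y) + lex_coboundary chi P (x - z).
Proof.
apply: coboundary_circular_order => [a|a b a0 b0 ab0]; rewrite /lex_coboundary.
  by rewrite oppr_eq0; case: eqVneq => [_|a0]; [rewrite oppr0|rewrite posN//; ring].
rewrite (negPf a0) (negPf b0) (negPf ab0).
have -> : 1 - 2 * pos a + (1 - 2 * pos b) - (1 - 2 * pos (a + b))
  = 1 - 2 * (pos a + pos b - pos (a + b)) by ring.
by case: (posD a0 b0 ab0) => ->.
Qed.

End LexicographicOrder.

(** * Characters with values in Q/Z *)

Lemma int_subgroup_principal (D : set int) :
  D 0 -> (forall x y, D x -> D y -> D (x - y)) ->
  exists2 d, D d & forall x, D x -> exists k, x = k * d.
Proof.
move=> D0 DB.
have DN x : D x -> D (- x) by move=> Dx; rewrite -sub0r; exact: DB.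
have DM x k : D x -> D (k * x).
  move=> Dx; have Dn (n : nat) : D (n%:Z * x).
    elim: n => [|n IH]; first by rewrite mul0r.
    by rewrite intS mulrDl mul1r addrC -[x in _ + x]opprK; apply: DB => //; exact: DN.
  by case: k => n; [exact: Dn|rewrite NegzE mulNr; exact: DN].
have [[x [Dx x0]]|H] := pselect (exists x, D x /\ x != 0); last first.
  exists 0 => // x Dx; exists 0; rewrite mul0r; apply/eqP/negPn/negP => x0.
  by apply: H; exists x.
have : exists n : nat, `[< D n%:Z >] && (0 < n)%N.
  exists `|x|%N; rewrite absz_gt0 x0 andbT; apply/asboolP.
  have [->//|->] : `|x|%N%:Z = x \/ `|x|%N%:Z = - x by lia.
  exact: DN.
move=> ex; case: (ex_minnP ex) => d /andP[/asboolP Dd d0] dmin.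
exists d%:Z => // y Dy; exists (y %/ d)%Z.
have Dm : D (y %% d)%Z by rewrite /modz; apply: DB => //; exact: DM.
have m0 : (0 <= y %% d)%Z by rewrite modz_ge0//; lia.
have md : (y %% d)%Z < d%:Z by apply: ltz_pmod; lia.
have : (y %% d)%Z = 0.
  case E : (y %% d)%Z Dm m0 md => [[//|n]|//] Dn _ nd.
  by have := dmin n.+1; rewrite (asboolT Dn)/= => /(_ isT); lia.
by move=> ym; rewrite {1}(divz_eq y d) ym addr0.
Qed.

(** Divisibility of Q/Z: values on generators that are integral on all relations define a character,
    and a character on the span of [g 0] extends one generator at a time. *)
Lemma extend_mod1 (B : zmodType) (g : nat -> B) (q : rat) :
  (forall k : int, g 0%N *~ k = 0 -> q * k%:~R \is a Num.int) ->
  forall n, exists2 y : nat -> rat, y 0%N = q &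
    forall c : nat -> int, \sum_(i < n.+1) g i *~ c i = 0 ->
      \sum_(i < n.+1) y i * (c i)%:~R \is a Num.int.
Proof.
move=> qP; elim=> [|n [y y0 IH]].
  by exists (fun=> q) => // c; rewrite !big_ord1; exact: qP.
pose comb (b : nat -> int) := \sum_(i < n.+1) g i *~ b i.
pose dot (b : nat -> int) : rat := \sum_(i < n.+1) y i * (b i)%:~R.
have combB b c k : comb (fun i => b i - k * c i) = comb b - comb c *~ k.
  rewrite /comb mulrz_suml -sumrB; apply: eq_bigr => i _.
  by rewrite mulrzBr [k * _]mulrC mulrzA.
have dotB b c k : dot (fun i => b i - k * c i) = dot b - k%:~R * dot c.
  rewrite /dot mulr_sumr -sumrB; apply: eq_bigr => i _.
  by rewrite rmorphB rmorphM/=; ring.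
have [||d [b bd] dP] := @int_subgroup_principal
    [set d | exists b, comb b + g n.+1 *~ d = 0].
- by exists (fun=> 0); rewrite /comb big1// mulr0z addr0.
- move=> x z [b bx] [c cz]; exists (fun i => b i - 1 * c i).
  by rewrite combB mulr1z mulrzBr addrACA -opprD bx cz subr0.
(* The multiples of the new generator lying in the old span are those by multiples of [d], so the
   new value is obtained by dividing by [d]. If [d] is 0 any value works, and the quotient is 0 by
   convention. *)
exists (fun i => if i == n.+1 then - dot b / d%:~R else y i) => // c.
rewrite !(big_ord_recr n.+1)/= eqxx -/(comb c) => cn.
under eq_bigr do rewrite ltn_eqF//.
rewrite -/(dot c); have [|k ck] := dP (c n.+1); first by exists c.
have [d0|d0] := eqVneq d 0.
  move: cn; rewrite ck d0 mulr0 mulr0z addr0 mulr0 addr0; exact: IH.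
have dQ : d%:~R != 0 :> rat by rewrite intr_eq0.
(* Subtracting [k] times the relation for [d] leaves a relation among the old generators. *)
suff : dot (fun i => c i - k * b i) \is a Num.int.
  by rewrite dotB ck rmorphM/= (_ : _ - _ = dot c + - dot b / d%:~R * (k%:~R * d%:~R))//; field.
apply: IH; rewrite -[LHS]/(comb (fun i => c i - k * b i)) combB; apply/eqP; rewrite subr_eq0.
move/eqP: cn; rewrite addr_eq0 => /eqP ->.
move/eqP: bd; rewrite addr_eq0 => /eqP ->.
by rewrite ck mulrC mulrzA mulNrz.
Qed.

(** The torsion generator [t], with annihilator generated by [m], is sent to [1 / m], and this
    character is extended to [A]. It is injective on torsion, so a maximal semigroup orders its
    kernel. *)
Lemma circular_order_exists (A : zmodType) :
  finitely_generated A -> cyclic_subgroup (torsion A) ->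
  exists phi : A * A * A -> sign3, left_invariant_circular_order phi.
Proof.
move=> /finitely_generated_coordinates[n [g [c cE]]] [t tT].
have tz k : torsion A (t *~ k) by rewrite tT; exists k.
have [||m tm mP] := @int_subgroup_principal [set k | t *~ k = 0].
- by [].
- by move=> x y /= tx ty; rewrite mulrzBr tx ty subr0.
have m0 : m%:~R != 0 :> rat.
  have [p p0 tp] := tz 1; rewrite intr_eq0; apply/eqP => m0.
  by have [|k] := mP p; rewrite ?m0 ?mulr0//; lia.
have divm k : (m%:~R^-1 * k%:~R : rat) \is a Num.int -> t *~ k = 0.
  case/intrP => l /(congr1 ( *%R m%:~R)); rewrite mulVKf// -intrM => /intr_inj ->.
  by rewrite mulrzA tm mul0rz.
(* [t] is placed at index 0, where the value is prescribed. *)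
pose g' i := if i is j.+1 then g j else t.
have [k tk|y y0 yP] := @extend_mod1 _ g' m%:~R^-1 _ n.
  have [l ->] := mP k tk.
  by rewrite intrM mulrC mulfK// intr_int.
pose chi a : rat := \sum_(i < n) y i.+1 * (c a i)%:~R.
have [P [PD PT Ptot]] := exists_maximal_semigroup A.
have [||||phi [co _]] := @lexicographic_circular_order _ chi P; last by exists phi.
- move=> a b.
  have := yP (fun i => if i is j.+1 then c (a + b) j - c a j - c b j else 0).
  rewrite !big_ord_recl/= mulr0z mulr0 !add0r.
  under eq_bigr do rewrite /= !mulrzBr.
  rewrite !sumrB -!cE -addrA -opprD subrr => /(_ erefl).
  under eq_bigr do rewrite /= !rmorphB/= !mulrBr.
  by rewrite !sumrB.
- exact: PD.
- by move/PT; apply; exact: torsion0.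
- move=> a ai a0; apply: Ptot; rewrite tT => -[k _ ak].
  move/eqP: a0; apply; rewrite -ak; apply: divm.
  (* The relation expressing [a] as [t *~ k] identifies [chi a] with [k / m] modulo 1. *)
  have := yP (fun i => if i is j.+1 then - c a j else k).
  rewrite !big_ord_recl/= y0.
  under eq_bigr do rewrite /= mulrNz.
  rewrite sumrN -cE ak subrr => /(_ erefl).
  under eq_bigr do rewrite /= rmorphN/= mulrN.
  by rewrite sumrN -/(chi a) => /rpredD/(_ ai); rewrite subrK.
Qed.

(** * Perturbation of circular orders *)

(** Two orders [psi1] and [psi2] agree with [phi] on [S] but orient a triple [(0, k, k + k)]
    oppositely, so one of them differs from [phi]. *)
Lemma circular_order_not_isolated (A : zmodType) (phi : A * A * A -> sign3)
    (a0 : A) (S : seq (A * A * A)) :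
  finitely_generated A -> ~ torsion A a0 -> left_invariant_circular_order phi ->
  exists psi : A * A * A -> sign3,
    [/\ left_invariant_circular_order psi, psi <> phi
      & forall t, t \in S -> psi t = phi t].
Proof.
move=> fg a0T co.
pose S' := flatten [seq [:: t.1.2 - t.1.1; t.2 - t.1.2; t.1.1 - t.2] | t <- S].
have [eta [etaD etaS]] := order_cocycle_split co S' fg.
have eta0 : eta 0 = 0 by have := etaD 0 0; rewrite (order_cocycle0 co) addr0 addrK.
have etaN a : eta (- a) = - eta a.
  have := etaD a (- a); rewrite subrr eta0 subr0.
  have -> : order_cocycle phi a (- a) = 0.
    by apply/(order_cocycle_eq0 co); rewrite subrr; do 2 right.
  by move/eqP; rewrite addrC addr_eq0 => /eqP.
(* The value at 0 is reset, since the formula would give 1/2. For nonzero [a], [b] and [a + b] the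
   defect of additivity is half of the cocycle minus 1, that is -1 or 0. *)
pose chi a := if a == 0 then 0 else (1 - eta a) / 2.
have chi0 : chi 0 = 0 by rewrite /chi eqxx.
have chi_eta a : a != 0 -> chi a = (1 - eta a) / 2 by rewrite /chi => /negPf ->.
have chiD a b : chi (a + b) - chi a - chi b \is a Num.int.
  have [->|an0] := eqVneq a 0; first by rewrite chi0 add0r [_ - 0]subr0 subrr.
  have [->|bn0] := eqVneq b 0; first by rewrite chi0 [_ - 0]subr0 addr0 subrr.
  have [/eqP|abn0] := eqVneq (a + b) 0.
    rewrite addrC addr_eq0 => /eqP bE; rewrite bE addNr chi0 !chi_eta ?oppr_eq0// etaN.
    by rewrite (_ : _ - _ = (-1)%:~R) ?intr_int//; field.
  rewrite !chi_eta//.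
  have -> : (1 - eta (a + b)) / 2 - (1 - eta a) / 2 - (1 - eta b) / 2
    = ((order_cocycle phi a b)%:~R - 1) / 2 by rewrite -etaD; field.
  have [->|/(order_cocycle_eq0 co)|->] := order_cocycle_cases phi a b.
  - by rewrite (_ : _ / _ = (-1)%:~R) ?intr_int.
  - by move=> [/eqP|[]/eqP]; rewrite ?(negPf an0) ?(negPf bn0) ?(negPf abn0).
  - by rewrite subrr mul0r.
have chi_itv a : a != 0 -> `|eta a| < 1 -> 0 < chi a < 1.
  by move=> an0; rewrite chi_eta// ltr_norml; lra.
have itv_nint (q : rat) : 0 < q < 1 -> q \isn't a Num.int.
  move=> q01; apply/negP => /intrP[m qm]; move: q01.
  by rewrite qm ltr0z (_ : 1 = 1%:~R)// ltr_int; lia.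
have chiN_int a : chi a \is a Num.int -> chi (- a) \is a Num.int.
  move=> ai; have := chiD a (- a); rewrite subrr chi0 sub0r => H.
  have -> : chi (- a) = - (- chi a - chi (- a)) - chi a by ring.
  by apply: rpredB => //; rewrite rpredN.
have [P [PD PT Ptot]] := exists_maximal_semigroup A.
have ker_torsion a : chi a \is a Num.int -> a != 0 -> ~ torsion A a.
  move=> ai an0 /(order_cocycle_split_torsion co etaD) /(chi_itv _ an0) /itv_nint.
  by rewrite ai.
pose Pop := [set a | P (- a)].
have [|||psi1 [co1 psi1E]] := @lexicographic_circular_order _ chi P chiD.
- exact: PD.
- by move/PT; apply; exact: torsion0.
- by move=> a ai an0; apply: Ptot; exact: ker_torsion.
have [|||psi2 [co2 psi2E]] := @lexicographic_circular_order _ chi Pop chiD.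
- by move=> x y Px Py; rewrite /Pop/= opprD; exact: PD.
- by rewrite /Pop/= oppr0 => /PT; apply; exact: torsion0.
- move=> a ai an0; rewrite /Pop/= opprK or_comm; apply: Ptot; exact: ker_torsion.
(* Here [chi a] lies strictly between 0 and 1, so it is its own position whatever the cone [Q]. *)
have lex_eta Q a : `|eta a| < 1 -> lex_coboundary chi Q a = eta a.
  move=> ea; rewrite /lex_coboundary; have [->|an0] := eqVneq a 0; first by rewrite eta0.
  have aitv := chi_itv _ an0 ea; rewrite /lex_position (negPf (itv_nint _ aitv)).
  rewrite (_ : Num.floor (chi a) = 0); last by apply: floor_def; lra.
  by rewrite subr0 chi_eta//; field.
have agree Q psi : (forall x y z, (val (psi (x, y, z)))%:~R = lex_coboundary chi Q (y - x)
      + lex_coboundary chi Q (z - y) + lex_coboundary chi Q (x - z)) ->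
    forall t, t \in S -> psi t = phi t.
  move=> psiE [[x y] z] tS; apply: val_inj; apply: (@intr_inj rat); rewrite psiE.
  have inS' u : u \in [:: y - x; z - y; x - z] -> `|eta u| < 1.
    by move=> uS; apply: etaS; apply/flattenP; exists [:: y - x; z - y; x - z] => //;
      apply/mapP; exists (x, y, z).
  rewrite !lex_eta ?inS' ?inE ?eqxx ?orbT//.
  have [_ _ /(_ x 0 (y - x) (z - x))] := co.
  rewrite addr0 (addrC x (y - x)) (addrC x (z - x)) !subrK => ->.
  have := etaD (y - x) (z - y); rewrite /order_cocycle [y - x + _]addrC subrKA => <-.
  by rewrite -etaN opprB.
have [k [kT ki kP]] : exists k, [/\ ~ torsion A k, chi k \is a Num.int & P k].
  have [m [mT mi]] : exists m, ~ torsion A m /\ chi m \is a Num.int.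
    (* Multiplying [a0] by the denominator of [chi a0] gives a non-torsion element of the kernel
       modulo 1. *)
    pose n := `|denq (chi a0)|%N.
    have chin p : chi (a0 *+ p) - p%:R * chi a0 \is a Num.int.
      elim: p => [|p IH]; first by rewrite mulr0n mul0r subr0 chi0.
      rewrite mulrS (_ : _ - _ = (chi (a0 + a0 *+ p) - chi a0 - chi (a0 *+ p))
        + (chi (a0 *+ p) - p%:R * chi a0)); first exact: rpredD.
      by rewrite -addn1 natrD; ring.
    exists (a0 *+ n); split.
      have : (0 < n)%N by rewrite absz_gt0 denq_neq0.
      by case: n => // n _ /torsion_mulrn.
    rewrite -[chi _](subrK (n%:R * chi a0)); apply: rpredD => //.
    rewrite pmulrn /n absz_denq mulrC -[X in X * _]divq_num_den.
    by rewrite mulfVK ?intr_int// intr_eq0 denq_neq0.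
  have [Pm|Pm] := Ptot _ mT; first by exists m.
  exists (- m); split=> //; first by move/torsionN.
  exact: chiN_int.
have [E|NE] := pselect (psi1 = phi); last first.
  by exists psi1; split=> //; exact: agree psi1E.
exists psi2; split=> //; last exact: agree psi2E.
(* At this triple [psi1] is 1 + 1 - 1 and [psi2] is -1 - 1 + 1. *)
rewrite -E => /(congr1 (fun psi => (val (psi (0, k, k + k)))%:~R : rat)).
have kk_int : chi (k + k) \is a Num.int.
  by rewrite -[chi _](subrK (chi k)); apply: rpredD => //; rewrite -[_ - _](subrK (chi k)) rpredD.
have nkk_int := chiN_int _ kk_int.
have Pkk : P (k + k) by exact: PD.
have PN a : P a -> ~ P (- a).
  by move=> Pa /(PD _ _ Pa); rewrite subrr => /PT; apply; exact: torsion0.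
have Pn0 a : P a -> a != 0.
  by move=> Pa; apply/eqP => a0'; apply: (PT a) => //; rewrite a0'; exact: torsion0.
have lexT (Q : set A) a : chi a \is a Num.int -> a != 0 -> Q a ->
    lex_coboundary chi Q a = 1.
  by move=> ai /negPf an0 Qa; rewrite /lex_coboundary an0 /lex_position ai asboolT.
have lexF (Q : set A) a : chi a \is a Num.int -> a != 0 -> ~ Q a ->
    lex_coboundary chi Q a = -1.
  by move=> ai /negPf an0 Qa; rewrite /lex_coboundary an0 /lex_position ai asboolF.
rewrite psi1E psi2E subr0 addrK sub0r.
rewrite (lexF Pop k) ?Pn0//; last exact: PN.
rewrite (lexT Pop (- (k + k))) ?oppr_eq0 ?Pn0//; last by rewrite /Pop/= opprK.
rewrite (lexT P k) ?Pn0// (lexF P (- (k + k))) ?oppr_eq0 ?Pn0//; last exact: PN.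
Qed.

(** * Recognition of the Cantor space *)

Lemma continuous_inverse (X Y : topologicalType) (f : X -> Y) (g : Y -> X) :
  cancel f g -> cancel g f -> continuous f -> compact [set: X] ->
  hausdorff_space Y -> continuous g.
Proof.
move=> fK gK fc cX hY; apply/continuous_closedP => C cC.
have -> : g @^-1` C = f @` C.
  apply/seteqP; split=> [y Cy|_ [x Cx <-]]; first by exists (g y).
  by rewrite /= fK.
apply: (compact_closed hY); apply: continuous_compact.
  exact: continuous_subspaceT.
exact: subclosed_compact cX _.
Qed.

Lemma zero_dimensional_hausdorff (X : topologicalType) :
  zero_dimensional X -> hausdorff_space X.
Proof.
move=> zX x y xy; apply/eqP/negPn/negP => /zX[U [[oU cU] Ux Uy]].
have [z [Uz]] := xy U (~` U) (open_nbhs_nbhs (conj oU Ux))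
  (open_nbhs_nbhs (conj (closed_openC cU) Uy)).
by [].
Qed.

Lemma prod_topology_continuous (X : topologicalType) (I : Type)
    (T : I -> topologicalType) (f : X -> prod_topology T) :
  (forall i, continuous (fun x => f x i)) -> continuous f.
Proof.
move=> fc x; apply/cvg_sup => i; move: x.
apply/(@continuousP _ (initial_topology (fun h : prod_topology T => h i))).
move=> _ [B oB <-]; move: (fc i) => /continuousP; exact.
Qed.

(** The filter generated by agreement with [x] on finitely many coordinates refines each
    coordinate's neighbourhood filter, hence converges to [x]. *)
Lemma nbhs_prod_topology (I : eqType) (T : I -> topologicalType)
    (x : prod_topology T) (V : set (prod_topology T)) :
  nbhs x V -> exists S : seq I, forall y, {in S, forall i, y i = x i} -> V y.
Proof.
pose F := filter_from [set: seq I]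
  (fun S => [set y : prod_topology T | {in S, forall i, y i = x i}]).
have FF : Filter F.
  apply: filter_from_filter; first by exists [::].
  move=> S S' _ _; exists (S ++ S') => // y yx.
  by split=> i iS; apply: yx; rewrite mem_cat iS ?orbT.
suff /(_ V) Fx : F --> x by move=> /Fx[S _ SV]; exists S.
apply/cvg_sup => i W [_ [[B oB <-] Bx] BW].
by exists [:: i] => // y yx; apply: BW; rewrite /= yx ?inE.
Qed.

Section CantorRecognition.
Variables (X : topologicalType) (x0 : X) (I : Type) (code : I -> nat).
Variable U : I -> set X.
Hypotheses (code_inj : injective code) (U_clopen : forall i, clopen (U i)).
Hypothesis U_sep : forall x y, x != y -> exists i, U i x /\ ~ U i y.
Hypotheses (X_compact : compact [set: X]) (X_perfect : forall x : X, ~ open [set x]).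

Let R : realType := Rdefinitions.R.
(** Maps points to Cantor space by their memberships in the clopen sets; positions that code no
    index carry a constant bit. *)
Let itinerary (x : X) : tree_of (fun=> bool) :=
  fun n => `[< exists2 i, code i = n & U i x >].

(* The library recognizes Cantor spaces among pointed pseudometric spaces; the
   topology of [X] is also the initial one for [itinerary], which is metric. *)
Let W0 : pseudoMetricType R := initial_topology itinerary.
Let W : pseudoPMetricType R :=
  HB.pack (W0 : Type) (PseudoMetric.class W0) (isPointed.Build W0 x0).

Let itinerary_code i x : itinerary x (code i) <-> U i x.
Proof.
rewrite /itinerary; split=> [/asboolP[j /code_inj ->]//|Ux].
by apply/asboolP; exists i.
Qed.

Let XW (x : X) : W := x.
Let WX (w : W) : X := w.

Let itinerary_clopen n : clopen [set x | itinerary x n].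
Proof.
have [[i <-]|ni] := pselect (exists i, code i = n).
  by rewrite (_ : [set x | _] = U i)//; apply/seteqP; split=> x /itinerary_code.
rewrite (_ : [set x | _] = set0).
  by split; [exact: open0|exact: closed0].
by apply/seteqP; split=> x //= /asboolP[i ci _]; apply: ni; exists i.
Qed.

Let XW_continuous : continuous XW.
Proof.
apply: continuous_comp_initial; apply: prod_topology_continuous => n.
apply/continuousP => B _; have [oU cU] := itinerary_clopen n.
have -> : (fun x => (itinerary \o XW) x n) @^-1` B =
    (if true \in B then [set x | itinerary x n] else set0) `|`
    (if false \in B then ~` [set x | itinerary x n] else set0).
  apply/seteqP; split=> x /=.
    case E : (itinerary x n) => Bx; [left|right]; rewrite mem_set//=.
    by rewrite E.
  case=> [|]; case: ifPn => // /set_mem; first by move=> + ->.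
  by move=> + /negP/negPf ->.
by apply: openU; case: ifP => _ //; [exact: open0|exact: closed_openC|exact: open0].
Qed.

Let W_zero_dimensional : zero_dimensional W.
Proof.
move=> x y /U_sep[i [Ux Uy]]; exists [set w : W | itinerary w (code i)].
split; [|exact/itinerary_code|by move/itinerary_code].
apply: (@preimage_clopen W (discrete_topology bool)
  (fun w => itinerary w (code i)) [set true]).
  by split; [exact: discrete_open|exact: discrete_closed].
move=> w; apply: (@continuous_comp W _ _ itinerary (proj (code i))).
  exact: initial_continuous.
exact: proj_continuous.
Qed.

Let W_hausdorff : hausdorff_space W := zero_dimensional_hausdorff W_zero_dimensional.

Let W_cantor_like : cantor_like W.
Proof.
split=> //.
- apply/perfectTP => w ow; apply: (X_perfect (x := WX w)).
  by move/continuousP : XW_continuous => /(_ [set w] ow).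
- have -> : [set: W] = XW @` [set: X] by apply/seteqP; split=> // w _; exists w.
  by apply: continuous_compact => //; exact: continuous_subspaceT.
Qed.

(** [XW] is the identity on points and continuous; its inverse is continuous because [X] is compact
    and [W] is Hausdorff. *)
Lemma clopen_family_cantor : homeomorphic X cantor_space.
Proof.
have [h [hc hcl]] := homeomorphism_cantor_like W_cantor_like.
have hK : cancel h h^-1%FUN by move=> c; rewrite funK// inE.
have hVK : cancel h^-1%FUN h by move=> w; rewrite invK// inE.
exists (h^-1%FUN \o XW), (WX \o h); split.
- by move=> x /=; rewrite hVK.
- by move=> c /=; rewrite hK.
- move=> x; apply: continuous_comp; first exact: XW_continuous.
  apply: (continuous_inverse hK hVK hc) => //; exact: cantor_space_compact.
- move=> c; apply: continuous_comp; first exact: hc.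
  exact: (@continuous_inverse _ _ XW WX).
Qed.

End CantorRecognition.

(** * The space of circular orders *)

Lemma compact_set_type (X : topologicalType) (K : set X) :
  compact K -> compact [set: set_type K].
Proof.
move=> cK G PG _.
have GK : (set_val @ G) K.
  by apply: (@filterE _ G) => x; rewrite /= set_valE; exact: set_valP.
have [p [Kp pcl]] := cK _ (fmap_proper_filter set_val PG) GK.
exists (exist _ p (mem_set Kp)); split=> // B V GB [_ [[D oD <-] Dp] DV].
have GB' : (set_val @ G) (set_val @` B).
  by apply: (@filterS _ G _ B) => // b Bb; exists b.
have [_ [[b Bb <-] Db]] := pcl _ D GB' (open_nbhs_nbhs (conj oD Dp)).
by exists b; split=> //; exact: DV.
Qed.

Lemma sign3_compact : compact [set: sign3].
Proof.
apply: finite_compact.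
pose s (m : int) (p : m \in [:: -1; 0; 1]) : sign3 := exist _ m p.
apply: (@sub_finite_set _ _ ([set s (-1) isT] `|` [set s 0 isT] `|` [set s 1 isT])).
  move=> e _; have [E|E|E] := sign3_cases e.
  - by left; left; exact: val_inj.
  - by left; right; exact: val_inj.
  - by right; exact: val_inj.
by rewrite !finite_setU; split; [split|]; exact: finite_set1.
Qed.

Section SpaceOfCircularOrders.
Variable A : zmodType.
Local Notation Phi := (prod_topology (fun _ : A * A * A => sign3)).

Lemma nbhs_agree (phi : Phi) (S : seq (A * A * A)) :
  nbhs phi [set psi : Phi | {in S, forall t, psi t = phi t}].
Proof.
elim: S => [|t S IH]; first by apply: filterE.
have H : nbhs phi [set psi : Phi | psi t = phi t].
  exact: (@proj_continuous _ (fun=> sign3) t phi _ (discrete_set1 (phi t))).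
apply: (@filterS _ (nbhs phi) _ _ _ _ (@filterI _ (nbhs phi) _ _ _ H IH)).
move=> psi [pt pS] u; rewrite inE => /predU1P[->|uS]; [exact: pt|exact: pS].
Qed.

(** Each instance of an axiom involves finitely many triples, and a point of the closure agrees
    there with some circular order; so [CO A] is closed in a compact product. *)
Lemma CO_compact : compact (CO A).
Proof.
have PhiC : compact [set: Phi].
  have := @tychonoff _ (fun _ : A * A * A => sign3) _ (fun=> sign3_compact).
  by congr compact; apply/seteqP; split.
apply: subclosed_compact PhiC _ => // phi cl.
have agree (S : seq (A * A * A)) : exists2 psi : Phi, left_invariant_circular_order psi &
    {in S, forall t, psi t = phi t}.
  by have [psi [? ?]] := cl _ (nbhs_agree phi S); exists psi.
split=> [x y z|g0 g1 g2 g3|g g0 g1 g2].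
- have [psi [co _ _] <-] := agree [:: (x, y, z)]; first exact: co.
  by rewrite inE.
- have [psi [_ co _] E] := agree
    [:: (g1, g2, g3); (g0, g2, g3); (g0, g1, g3); (g0, g1, g2)].
  by rewrite -!E ?inE ?eqxx ?orbT//; exact: co.
- have [psi [_ _ co] E] := agree [:: (g + g0, g + g1, g + g2); (g0, g1, g2)].
  by rewrite -!E ?inE ?eqxx ?orbT//; exact: co.
Qed.

Lemma CO_perfect (a : A) (x : set_type (CO A)) :
  finitely_generated A -> ~ torsion A a -> ~ open [set x].
Proof.
move=> fg aT [V oV Vx].
have Vvx : V (set_val x) by have : (set_val @^-1` V) x by rewrite Vx.
have [S SV] := nbhs_prod_topology (open_nbhs_nbhs (conj oV Vvx)).
have [psi [co neq agree]] := circular_order_not_isolated S fg aT (set_valP x).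
have : (set_val @^-1` V) (exist _ psi (mem_set co) : set_type (CO A)) by exact: SV.
by rewrite Vx => e; apply: neq; rewrite -e.
Qed.

Lemma CO_clopen (t : A * A * A) (e : sign3) :
  clopen [set x : set_type (CO A) | set_val x t = e].
Proof.
apply: (@preimage_clopen (set_type (CO A)) sign3
  (fun x => (set_val x : Phi) t) [set e]).
  by split; [exact: discrete_open|exact: discrete_closed].
move=> x; apply: (@continuous_comp _ Phi _ set_val (proj t)).
  exact: initial_continuous.
exact: proj_continuous.
Qed.

End SpaceOfCircularOrders.

(** * Countability of the group, and the Cantor criterion applied to its circular orders *)

Lemma finitely_generated_code (A : zmodType) :
  finitely_generated A -> exists code : A -> nat, injective code.
Proof.
move=> /finitely_generated_coordinates[n [g [c cE]]].
exists (fun x => pickle [ffun i : 'I_n => c x i]) => x y.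
move=> /(pcan_inj (@pickleK _))/ffunP xy; rewrite [LHS]cE [RHS]cE.
by apply: eq_bigr => i _; have := xy i; rewrite !ffunE => ->.
Qed.

Lemma independent_not_torsion (A : zmodType) (n : nat) (g : 'I_n -> A) (i : 'I_n) :
  Z_independent g -> ~ torsion A (g i).
Proof.
move=> indep [m m0 gm].
have /(_ i) : forall j, (if j == i then m%:Z else 0) = 0.
  apply: indep; rewrite (bigD1 i)//= eqxx -pmulrn gm add0r big1// => j /negPf ->.
  by rewrite mulr0z.
by rewrite eqxx; lia.
Qed.

Theorem theorem3p10 (A : zmodType) (r : nat)
  (A_fg : finitely_generated A)
  (A_rank : has_rank A r) (r_gt0 : (0 < r)%N)
  (A_tors : cyclic_subgroup (torsion A)) :
  homeomorphic (set_type (CO A)) cantor_space.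
Proof.
have [[g /(independent_not_torsion (i := Ordinal r_gt0)) aT] _] := A_rank.
have [phi co] := circular_order_exists A_fg A_tors.
have [c c_inj] := finitely_generated_code A_fg.
pose code (i : A * A * A * sign3) :=
  pickle (c i.1.1.1, c i.1.1.2, c i.1.2, val i.2).
pose x0 : set_type (CO A) := exist _ phi (mem_set co).
(* Distinct orders differ at some triple, so these countably many clopen sets separate points. *)
pose U (i : A * A * A * sign3) := [set x : set_type (CO A) | set_val x i.1 = i.2].
apply: (@clopen_family_cantor (set_type (CO A)) x0 _ code U).
- move=> [[[a1 a2] a3] e] [[[b1 b2] b3] e'] /(pcan_inj (@pickleK _))[].
  by move=> /c_inj -> /c_inj -> /c_inj -> /val_inj ->.
- by move=> [t e]; exact: CO_clopen.
- move=> x y xy; have [t xyt] : exists t, set_val x t <> set_val y t.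
    apply/existsNP => xyE; move/eqP: xy; apply; apply: val_inj.
    exact/funext.
  by exists (t, set_val x t); split=> // /esym.
- exact/compact_set_type/CO_compact.
- by move=> x; exact: CO_perfect A_fg aT.
Qed.
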